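(* There is a natural equivalence of categories $$\mathcal{F}_{iso}\simeq\prod_{V\in\mathcal{S}}\mathbb{F}_2[O(V)]\text{-mod},$$ where $\mathcal{S}$ is a set of representatives of the isometry classes of finite-dimensional (possibly degenerate) quadratic spaces over $\mathbb{F}_2$ and $O(V)$ is the group of isometries of $V$.
   Context: A quadratic form on a finite-dimensional $\mathbb{F}_2$-vector space $V$ is $q:V\to\mathbb{F}_2$ with $q(x+y)+q(x)+q(y)$ bilinear. $\mathcal{E}_q^{deg}$: objects finite-dimensional quadratic spaces (possibly degenerate), morphisms injective linear maps preserving the quadratic forms; it has pullbacks (intersection of images with restricted form). $\mathrm{Sp}(\mathcal{E}_q^{deg})$: same objects; morphisms $V\to W$ are spans $[V\leftarrow D\rightarrow W]$ in $\mathcal{E}_q^{deg}$ up to isomorphism of $D$ compatible with both legs, composed by pullback. $\mathcal{E}$ is the category of all $\mathbb{F}_2$-vector spaces and $\mathcal{F}_{iso}=\mathrm{Func}(\mathrm{Sp}(\mathcal{E}_q^{deg}),\mathcal{E})$. *)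

(* Defs.v *)
From HB Require Import structures.
From mathcomp Require Import all_boot all_order all_algebra.
Set Implicit Arguments. Unset Strict Implicit. Unset Printing Implicit Defensive.
Import GRing.Theory.
Local Open Scope ring_scope.

Definition polar (V : vectType 'F_2) (q : V -> 'F_2) (x y : V) : 'F_2 :=
  q (x + y) + q x + q y.

Definition is_quadratic (V : vectType 'F_2) (q : V -> 'F_2) : Prop :=
  (forall (a : 'F_2) (x x' y : V),
      polar q (a *: x + x') y = a * polar q x y + polar q x' y) /\
  (forall (a : 'F_2) (x y y' : V),
      polar q x (a *: y + y') = a * polar q x y + polar q x y').

Record qspace := QSpace {
  qvs :> vectType 'F_2;
  qform : qvs -> 'F_2;
  qformP : is_quadratic qform }.
Arguments qform : clear implicits.

Record qmor (V W : qspace) := QMor {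
  qmap :> 'Hom(V, W);
  qmap_inj : injective (fun_of_lfun qmap);
  qmap_pres : forall x, qform W (qmap x) = qform V x }.

Record span (V W : qspace) := Span {
  apex : qspace;
  lleg : qmor apex V;
  rleg : qmor apex W }.

Definition span_iso (V W : qspace) (s t : span V W) : Prop :=
  exists h : qmor (apex s) (apex t),
    bijective (fun_of_lfun (qmap h)) /\
    (forall x, lleg t (h x) = lleg s x) /\
    (forall x, rleg t (h x) = rleg s x).

Definition qmor_id (V : qspace) : qmor V V.
Proof.
refine (@QMor V V \1%VF _ _).
- by move=> x y; rewrite !id_lfunE.
- by move=> x; rewrite id_lfunE.
Defined.

Definition span_id (V : qspace) : span V V := Span (qmor_id V) (qmor_id V).

(* composition of spans by pullback: the apex is the intersection of the
   images of the two inner legs, with the restricted quadratic form *)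
Section Pullback.
Variables (W : qspace) (D E : qspace) (b : qmor D W) (c : qmor E W).

Definition pb_vs : vectType 'F_2 :=
  subvs_of (limg (qmap b) :&: limg (qmap c))%VS.

Definition pb_form (x : pb_vs) : 'F_2 := qform W (vsval x).

Lemma pb_formP : is_quadratic pb_form.
Proof.
have [H1 H2] := qformP W.
set U := (limg (qmap b) :&: limg (qmap c))%VS.
have vD (u w : subvs_of U) : vsval (u + w) = vsval u + vsval w.
  exact: raddfD.
have vZ (a : 'F_2) (u : subvs_of U) : vsval (a *: u) = a *: vsval u.
  exact: linearZ.
split=> a x x' y; rewrite /polar /pb_form /=.
- exact: H1.
- exact: H2.
Qed.

Definition pb_space : qspace := QSpace pb_formP.

Lemma pb_memb (x : pb_space) : vsval x \in limg (qmap b).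
Proof. by have /memv_capP[] := subvsP x. Qed.

Lemma pb_memc (x : pb_space) : vsval x \in limg (qmap c).
Proof. by have /memv_capP[] := subvsP x. Qed.

Definition pb_hb : 'Hom(pb_space, D) :=
  ((qmap b)^-1 \o linfun (@vsval _ _ (limg (qmap b) :&: limg (qmap c))%VS))%VF.
Definition pb_hc : 'Hom(pb_space, E) :=
  ((qmap c)^-1 \o linfun (@vsval _ _ (limg (qmap b) :&: limg (qmap c))%VS))%VF.

Lemma pb_hbK (x : pb_space) : qmap b (pb_hb x) = vsval x.
Proof. by rewrite /pb_hb comp_lfunE lfunE /= limg_lfunVK // pb_memb. Qed.
Lemma pb_hcK (x : pb_space) : qmap c (pb_hc x) = vsval x.
Proof. by rewrite /pb_hc comp_lfunE lfunE /= limg_lfunVK // pb_memc. Qed.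

Definition pb_legb : qmor pb_space D.
Proof.
refine (@QMor pb_space D pb_hb _ _).
- by move=> x y /(congr1 (fun_of_lfun (qmap b))); rewrite !pb_hbK; apply: val_inj.
- by move=> x; rewrite -(qmap_pres b) pb_hbK.
Defined.

Definition pb_legc : qmor pb_space E.
Proof.
refine (@QMor pb_space E pb_hc _ _).
- by move=> x y /(congr1 (fun_of_lfun (qmap c))); rewrite !pb_hcK; apply: val_inj.
- by move=> x; rewrite -(qmap_pres c) pb_hcK.
Defined.
End Pullback.

Definition qmor_comp (U V W : qspace) (f : qmor V W) (g : qmor U V) : qmor U W.
Proof.
refine (@QMor U W (qmap f \o qmap g)%VF _ _).
- by move=> x y; rewrite !comp_lfunE => /qmap_inj /qmap_inj.
- by move=> x; rewrite comp_lfunE !qmap_pres.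
Defined.

Definition span_comp (U V W : qspace) (s : span U V) (t : span V W) : span U W :=
  Span (qmor_comp (lleg s) (pb_legb (rleg s) (lleg t)))
       (qmor_comp (rleg t) (pb_legc (rleg s) (lleg t))).

Record linmap (A B : lmodType 'F_2) := LinMap {
  lapp :> A -> B;
  lappP : forall (a : 'F_2) (x y : A), lapp (a *: x + y) = a *: lapp x + lapp y }.

Definition linmap_id (A : lmodType 'F_2) : linmap A A :=
  @LinMap A A id (fun _ _ _ => erefl).

Definition linmap_comp (A B C : lmodType 'F_2) (f : linmap B C) (g : linmap A B)
  : linmap A C.
Proof.
refine (@LinMap A C (fun x => f (g x)) _).
by move=> a x y; rewrite !lappP.
Defined.

(* A functor Sp(E_q^deg) -> E.  Morphisms of Sp(E_q^deg) are spans up to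
   isomorphism, so the action on spans is required to be invariant under
   isomorphism of spans. *)
Record SpFunctor := SpFun {
  Fobj : qspace -> lmodType 'F_2;
  Fmor : forall V W : qspace, span V W -> linmap (Fobj V) (Fobj W);
  Fmor_iso : forall (V W : qspace) (s t : span V W),
      span_iso s t -> forall x, Fmor s x = Fmor t x;
  Fmor_id : forall (V : qspace) x, Fmor (span_id V) x = x;
  Fmor_comp : forall (U V W : qspace) (s : span U V) (t : span V W) x,
      Fmor (span_comp s t) x = Fmor t (Fmor s x) }.

Record NatTrans (F G : SpFunctor) := NatT {
  ntc :> forall V : qspace, linmap (Fobj F V) (Fobj G V);
  ntcP : forall (V W : qspace) (s : span V W) x,
      ntc W (Fmor F s x) = Fmor G s (ntc V x) }.

Definition nat_id (F : SpFunctor) : NatTrans F F.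
Proof. by refine (@NatT F F (fun V => linmap_id (Fobj F V)) _). Defined.

Definition nat_comp (F G H : SpFunctor) (e : NatTrans G H) (d : NatTrans F G)
  : NatTrans F H.
Proof.
refine (@NatT F H (fun V => linmap_comp (e V) (d V)) _).
by move=> V W s x /=; rewrite !ntcP.
Defined.

Definition isometry (V : qspace) (g : 'Hom(V, V)) : Prop :=
  bijective (fun_of_lfun g) /\ forall x, qform V (g x) = qform V x.

Definition isometric (V W : qspace) : Prop :=
  exists f : 'Hom(V, W),
    bijective (fun_of_lfun f) /\ forall x, qform W (f x) = qform V x.

Record OMod (V : qspace) := OModule {
  omod : lmodType 'F_2;
  oact : forall g : 'Hom(V, V), isometry g -> linmap omod omod;
  oact_id : forall (H : isometry \1%VF) x, oact H x = x;
  oact_comp : forall (g h : 'Hom(V, V)) (Hg : isometry g) (Hh : isometry h)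
      (Hgh : isometry (g \o h)%VF) x,
      oact Hgh x = oact Hg (oact Hh x) }.
Arguments oact {V} o {g} H.

Record OHom (V : qspace) (M N : OMod V) := OHomB {
  ohom :> linmap (omod M) (omod N);
  ohomP : forall (g : 'Hom(V, V)) (Hg : isometry g) x,
      ohom (oact M Hg x) = oact N Hg (ohom x) }.

Definition ohom_id (V : qspace) (M : OMod V) : OHom M M.
Proof. by refine (@OHomB V M M (linmap_id _) _). Defined.

Definition ohom_comp (V : qspace) (M N P : OMod V) (f : OHom N P) (g : OHom M N)
  : OHom M P.
Proof.
refine (@OHomB V M P (linmap_comp f g) _).
by move=> h Hh x /=; rewrite !ohomP.
Defined.

Record Category := Cat {
  Ob : Type;
  Hom : Ob -> Ob -> Type;
  cid : forall a, Hom a a;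
  ccomp : forall a b c, Hom b c -> Hom a b -> Hom a c }.
Arguments cid {_} a.
Arguments ccomp {_ a b c} _ _.

Record Functor (C D : Category) := Fun {
  fob :> Ob C -> Ob D;
  fmap : forall a b, Hom a b -> Hom (fob a) (fob b);
  fmap_id : forall a, fmap (cid a) = cid (fob a);
  fmap_comp : forall a b c (f : Hom b c) (g : Hom a b),
      fmap (ccomp f g) = ccomp (fmap f) (fmap g) }.
Arguments fmap {_ _} _ {a b} _.

Definition functor_id (C : Category) : Functor C C.
Proof. by refine (@Fun C C id (fun a b f => f) _ _). Defined.

Definition functor_comp (C D E : Category) (G : Functor D E) (F : Functor C D)
  : Functor C E.
Proof.
refine (@Fun C E (fun a => G (F a)) (fun a b f => fmap G (fmap F f)) _ _).
- by move=> a; rewrite !fmap_id.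
- by move=> a b c f g; rewrite !fmap_comp.
Defined.

Definition nat_iso (C D : Category) (F G : Functor C D) : Prop :=
  exists (al : forall a, Hom (F a) (G a)) (be : forall a, Hom (G a) (F a)),
    (forall a, ccomp (al a) (be a) = cid (G a)) /\
    (forall a, ccomp (be a) (al a) = cid (F a)) /\
    (forall a b (f : Hom a b), ccomp (fmap G f) (al a) = ccomp (al b) (fmap F f)).

Definition cat_equivalent (C D : Category) : Prop :=
  exists (F : Functor C D) (G : Functor D C),
    nat_iso (functor_comp G F) (functor_id C) /\
    nat_iso (functor_comp F G) (functor_id D).

Definition Fiso_cat : Category :=
  @Cat SpFunctor NatTrans nat_id (fun F G H e d => nat_comp e d).

Definition prod_OMod_cat (I : Type) (rep : I -> qspace) : Category :=
  @Cat (forall i, OMod (rep i))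
       (fun M N => forall i, OHom (M i) (N i))
       (fun M i => ohom_id (M i))
       (fun M N P f g i => ohom_comp (f i) (g i)).

Definition isometry_class_reps (I : Type) (rep : I -> qspace) : Prop :=
  (forall V : qspace, exists i, isometric V (rep i)) /\
  (forall i j, isometric (rep i) (rep j) -> i = j).

(* Main.v *)
Require Import Defs.
From HB Require Import structures.
From mathcomp Require Import all_boot all_order all_algebra.
From mathcomp Require Import boolp.
Import Defs.

(** The endomorphisms [V <- U -> V] attached to the subspaces [U] of [V] are commuting
    idempotents of [V] in the category of spans, so a functor [F] splits as
    [F V = sum_(U <= V) P_F U], where the primitive part [P_F V] is the subspace killed
    by every span out of [V] whose left leg is not onto. Spans preserve this
    decomposition and act on primitive parts through isometries only, so [F] is
    determined by the [O(V)]-modules [P_F V], with [V] a representative.  Conversely,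
    modules [M i] over [O(rep i)] induce the functor sending [V] to the families
    [m f] in [M i], [f : rep i -> V], with [m f = g . m (f \o g)] for [g] in [O(rep i)];
    a span [(l, r)] sends [m] to the family with value [m (l \o f')] at
    [f = r \o f'] and [0] at the [f] that do not factor through [r]. *)

Set Implicit Arguments. Unset Strict Implicit. Unset Printing Implicit Defensive.
Import GRing.Theory.
Local Open Scope ring_scope.

Local Notation F2 := 'F_2.

(** * Vector spaces of arbitrary dimension *)

Lemma linmap_ext (A B : lmodType F2) (f g : linmap A B) : f =1 g -> f = g.
Proof.
case: f g => f fP [g gP] /= /funext fg; case: g / fg gP => gP.
by congr LinMap.
Qed.

HB.instance Definition _ (A B : lmodType F2) (f : linmap A B) :=
  GRing.isLinear.Build F2 A B *:%R (lapp f) (lappP f).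

Section LinearInverse.
Variables (A B : lmodType F2) (f : linmap A B).
Hypothesis f_inj : injective f.
Hypothesis f_surj : forall y, exists x, f x = y.

(** The spaces may have infinite dimension, so the inverse of a bijective linear map is obtained by
    classical choice, and its linearity is deduced from injectivity. *)
Definition linv_fun (y : B) : A := projT1 (boolp.cid (f_surj y)).

Lemma linv_funK : cancel linv_fun f.
Proof. by move=> y; rewrite /linv_fun; case: boolp.cid. Qed.

Lemma linv_fun_linear a x y :
  linv_fun (a *: x + y) = a *: linv_fun x + linv_fun y.
Proof. by apply: f_inj; rewrite lappP !linv_funK. Qed.

Definition linv : linmap B A := LinMap linv_fun_linear.

Lemma linvK : cancel linv f. Proof. exact: linv_funK. Qed.

Lemma linvKV : cancel f linv.
Proof. by move=> x; apply: f_inj; rewrite linvK. Qed.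
End LinearInverse.

Section DependentProduct.
Variables (T : Type) (M : T -> lmodType F2).

Definition dprod := forall t, M t.

HB.instance Definition _ := gen_eqMixin dprod.
HB.instance Definition _ := gen_choiceMixin dprod.

Let add (x y : dprod) : dprod := fun t => x t + y t.
Let opp (x : dprod) : dprod := fun t => - x t.
Let zero : dprod := fun t => 0.
Let scale (a : F2) (x : dprod) : dprod := fun t => a *: x t.

Let addA : associative add.
Proof. by move=> x y z; apply: functional_extensionality_dep => t; apply: addrA. Qed.
Let addC : commutative add.
Proof. by move=> x y; apply: functional_extensionality_dep => t; apply: addrC. Qed.
Let add0 : left_id zero add.
Proof. by move=> x; apply: functional_extensionality_dep => t; apply: add0r. Qed.
Let addN : left_inverse zero opp add.
Proof. by move=> x; apply: functional_extensionality_dep => t; apply: addNr. Qed.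

HB.instance Definition _ := GRing.isZmodule.Build dprod addA addC add0 addN.

Let scaleA a b (x : dprod) : scale a (scale b x) = scale (a * b) x.
Proof. by apply: functional_extensionality_dep => t; apply: scalerA. Qed.
Let scale1 : left_id 1 scale.
Proof. by move=> x; apply: functional_extensionality_dep => t; apply: scale1r. Qed.
Let scaleDr : right_distributive scale +%R.
Proof. by move=> a x y; apply: functional_extensionality_dep => t; apply: scalerDr. Qed.
Let scaleDl (x : dprod) : {morph scale^~ x : a b / a + b}.
Proof. by move=> a b; apply: functional_extensionality_dep => t; apply: scalerDl. Qed.

HB.instance Definition _ :=
  GRing.Zmodule_isLmodule.Build F2 dprod scaleA scale1 scaleDr scaleDl.
End DependentProduct.

(** Membership is a [Prop] rather than a boolean: primitivity, the main instance, quantifies over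
    all quadratic spaces and all spans. *)
Record submodule (A : lmodType F2) := Submodule {
  sm_pred :> A -> Prop;
  sm_pred0 : sm_pred 0;
  sm_predP : forall (a : F2) x y, sm_pred x -> sm_pred y -> sm_pred (a *: x + y) }.

Record sm_elt (A : lmodType F2) (S : submodule A) := SmElt {
  sm_val :> A;
  sm_valP : S sm_val }.

Lemma sm_val_inj (A : lmodType F2) (S : submodule A) :
  injective (@sm_val A S).
Proof.
by move=> [x xP] [y yP] /= xy; case: y / xy yP => yP; congr SmElt.
Qed.

Section SubmoduleLmod.
Variables (A : lmodType F2) (S : submodule A).
Local Notation T := (sm_elt S).

HB.instance Definition _ := gen_eqMixin T.
HB.instance Definition _ := gen_choiceMixin T.

Let S_scale (a : F2) x : S x -> S (a *: x).
Proof. by move=> Sx; rewrite -[_ *: _]addr0; apply: sm_predP (sm_pred0 _). Qed.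
Let S_add x y : S x -> S y -> S (x + y).
Proof. by move=> Sx Sy; rewrite -[x]scale1r; apply: sm_predP. Qed.
Let S_opp x : S x -> S (- x).
Proof. by move=> Sx; rewrite -scaleN1r; apply: S_scale. Qed.

Let add (x y : T) : T := SmElt (S_add (sm_valP x) (sm_valP y)).
Let opp (x : T) : T := SmElt (S_opp (sm_valP x)).
Let zero : T := SmElt (sm_pred0 S).
Let scale (a : F2) (x : T) : T := SmElt (S_scale a (sm_valP x)).

Let addA : associative add.
Proof. by move=> x y z; apply: sm_val_inj; apply: addrA. Qed.
Let addC : commutative add.
Proof. by move=> x y; apply: sm_val_inj; apply: addrC. Qed.
Let add0 : left_id zero add.
Proof. by move=> x; apply: sm_val_inj; apply: add0r. Qed.
Let addN : left_inverse zero opp add.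
Proof. by move=> x; apply: sm_val_inj; apply: addNr. Qed.

HB.instance Definition _ := GRing.isZmodule.Build T addA addC add0 addN.

Let scaleA a b (x : T) : scale a (scale b x) = scale (a * b) x.
Proof. by apply: sm_val_inj; apply: scalerA. Qed.
Let scale1 : left_id 1 scale.
Proof. by move=> x; apply: sm_val_inj; apply: scale1r. Qed.
Let scaleDr : right_distributive scale +%R.
Proof. by move=> a x y; apply: sm_val_inj; apply: scalerDr. Qed.
Let scaleDl (x : T) : {morph scale^~ x : a b / a + b}.
Proof. by move=> a b; apply: sm_val_inj; apply: scalerDl. Qed.

HB.instance Definition _ :=
  GRing.Zmodule_isLmodule.Build F2 T scaleA scale1 scaleDr scaleDl.
End SubmoduleLmod.

Definition sm_map (A B : lmodType F2) (S : submodule A) (T : submodule B)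
    (f : linmap A B) (fP : forall x, S x -> T (f x)) :
  linmap (sm_elt S) (sm_elt T).
Proof.
refine (@LinMap (sm_elt S) (sm_elt T) (fun x => SmElt (fP _ (sm_valP x))) _).
by move=> a x y; apply: sm_val_inj; apply: lappP.
Defined.

(** * Isometric embeddings *)

Lemma qmor_ext (V W : qspace) (f g : qmor V W) : f =1 g -> f = g.
Proof.
case: f g => f fi fp [g gi gp] /= /lfunP fg.
by case: g / fg gi gp => gi gp; congr QMor.
Qed.

Definition onto (V W : qspace) (f : qmor V W) : bool := limg (qmap f) == fullv.

Lemma ontoP (V W : qspace) (f : qmor V W) :
  reflect (forall y, exists x, f x = y) (onto f).
Proof.
apply: (iffP eqP) => [f_full y|f_surj].
  by have /memv_imgP[x _ ->] : y \in limg (qmap f);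
    [rewrite f_full memvf | exists x].
by apply/vspaceP => y; rewrite memvf; have [x <-] := f_surj y;
  rewrite memv_img ?memvf.
Qed.

Lemma onto_bij (V W : qspace) (f : qmor V W) :
  onto f -> bijective (fun_of_lfun (qmap f)).
Proof.
move=> /ontoP f_surj.
exists (fun y => projT1 (boolp.cid (f_surj y))) => [x|y]; last by case: boolp.cid.
by apply: (qmap_inj (q := f)); case: boolp.cid.
Qed.

Lemma onto_isometry (V : qspace) (f : qmor V V) : onto f -> isometry (qmap f).
Proof. by move=> /onto_bij f_bij; split=> //; apply: qmap_pres. Qed.

Lemma onto_isometric (V W : qspace) (f : qmor V W) : onto f -> isometric V W.
Proof. by move=> /onto_bij f_bij; exists (qmap f); split=> //; apply: qmap_pres. Qed.

Definition isometry_qmor (V : qspace) (g : 'Hom(V, V)) (Hg : isometry g) : qmor V V :=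
  QMor (bij_inj Hg.1) Hg.2.

Lemma isometry_onto (V : qspace) (g : 'Hom(V, V)) (Hg : isometry g) :
  onto (isometry_qmor Hg).
Proof. by apply/ontoP => y; have [h _ gh] := Hg.1; exists (h y); apply: gh. Qed.

Lemma isometric_qmor (V W : qspace) : isometric V W ->
  exists f : qmor W V, onto f.
Proof.
move=> [f [f_bij f_pres]]; have f_inj := bij_inj f_bij.
have f_ker : lker f == 0%VS by apply/lker0P.
have fK : cancel f^-1%VF f.
  move=> y; have [h _ fh] := f_bij.
  by rewrite -[y]fh lker0_lfunK.
have fV_pres y : qform V (f^-1%VF y) = qform W y by rewrite -f_pres fK.
exists (QMor (can_inj fK) fV_pres).
by apply/ontoP => x; exists (f x); rewrite /= lker0_lfunK.
Qed.

Lemma onto_id (V : qspace) : onto (qmor_id V).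
Proof. by apply/ontoP => y; exists y; rewrite /= id_lfunE. Qed.

Lemma onto_comp (U V W : qspace) (f : qmor V W) (g : qmor U V) :
  onto f -> onto g -> onto (qmor_comp f g).
Proof.
move=> /ontoP f_surj /ontoP g_surj; apply/ontoP => y.
have [x <-] := f_surj y; have [z <-] := g_surj x.
by exists z; rewrite /= comp_lfunE.
Qed.

Lemma onto_compl (U V W : qspace) (f : qmor V W) (g : qmor U V) :
  onto (qmor_comp f g) -> onto f.
Proof.
move=> /ontoP fg_surj; apply/ontoP => y; have [x <-] := fg_surj y.
by exists (g x); rewrite /= comp_lfunE.
Qed.

Section Lift.
Variables (V W D : qspace) (f : qmor V W) (r : qmor D W).
Hypothesis fr : (limg (qmap f) <= limg (qmap r))%VS.

Lemma qlift_subproof x : r (((qmap r)^-1 \o qmap f)%VF x) = f x.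
Proof. by rewrite comp_lfunE limg_lfunVK // (subvP fr) // memv_img ?memvf. Qed.

Definition qlift : qmor V D.
Proof.
refine (@QMor V D ((qmap r)^-1 \o qmap f)%VF _ _).
- by move=> x y /(congr1 r); rewrite !qlift_subproof => /qmap_inj.
- by move=> x; rewrite -(qmap_pres r) qlift_subproof qmap_pres.
Defined.

Lemma qliftK x : r (qlift x) = f x. Proof. exact: qlift_subproof. Qed.
End Lift.

Lemma limg_leP (V W D : qspace) (f : qmor V W) (r : qmor D W) :
  (forall x, exists y, f x = r y) <-> (limg (qmap f) <= limg (qmap r))%VS.
Proof.
split=> [fr|fr x]; last by exists (qlift fr x); rewrite qliftK.
apply/subvP => _ /memv_imgP[x _ ->]; have [y ->] := fr x.
by rewrite memv_img ?memvf.
Qed.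

Lemma limg_le_onto (V W D : qspace) (f : qmor V W) (r : qmor D W) :
  onto r -> (limg (qmap f) <= limg (qmap r))%VS.
Proof. by move=> /eqP->; apply: subvf. Qed.

Section Restriction.
Variables (V : qspace) (U : {vspace V}).

Definition qsub_form (x : subvs_of U) : F2 := qform V (vsval x).

Lemma qsub_formP : is_quadratic qsub_form.
Proof.
have [H1 H2] := qformP V.
split=> a x x' y; [exact: H1 | exact: H2].
Qed.

Definition qsub : qspace := QSpace qsub_formP.

Lemma qincl_subproof (x : qsub) : linfun (@vsval _ _ U) x = vsval x.
Proof. by rewrite lfunE. Qed.

Definition qincl : qmor qsub V.
Proof.
refine (@QMor qsub V (linfun (@vsval _ _ U)) _ _).
- by move=> x y; rewrite !qincl_subproof; apply: val_inj.
- by move=> x; rewrite qincl_subproof.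
Defined.

Lemma mem_qincl x : qincl x \in U.
Proof. by rewrite [qincl x]qincl_subproof subvsP. Qed.

Lemma limg_qincl : limg (qmap qincl) = U.
Proof.
apply/vspaceP => x; apply/memv_imgP/idP => [[y _ ->]|Ux].
  exact: mem_qincl.
by exists (vsproj U x); rewrite ?memvf // [RHS]qincl_subproof vsprojK.
Qed.
End Restriction.

Lemma dim_qsub_lt (V : qspace) (U : {vspace V}) :
  U != fullv -> (\dim (@fullv _ (qsub U)) < \dim (@fullv _ V))%N.
Proof.
move=> U_proper; rewrite dimvf -[X in (X < _)%N]/(\dim U).
by rewrite ltn_neqAle (dimv_leqif_eq (subvf U)).2 U_proper dimvS ?subvf.
Qed.

(** In a fixed basis every subspace is the row space of a square matrix, and over a finite field
    there are finitely many of these. *)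
Lemma vspace_enum (V : vectType F2) :
  exists s : seq {vspace V}, uniq s /\ forall U, U \in s.
Proof.
pose e := vbasis {:V}.
exists (undup [seq passmx.vsof e A | A <- enum {: 'M[F2]_(\dim {:V})}]); split.
  exact: undup_uniq.
move=> U; rewrite mem_undup -[U](passmx.msofK (vbasisP {:V})).
by rewrite map_f ?mem_enum.
Qed.

(** * Spans *)

Lemma pullbackP (W D E : qspace) (b : qmor D W) (c : qmor E W) x y :
  b x = c y ->
  exists z : pb_space b c, pb_legb b c z = x /\ pb_legc b c z = y.
Proof.
move=> bx_cy.
have bxP : b x \in (limg (qmap b) :&: limg (qmap c))%VS.
  by rewrite memv_cap {2}bx_cy !memv_img ?memvf.
exists (vsproj _ (b x)); split.
  by apply: (qmap_inj (q := b)); rewrite [LHS]pb_hbK vsprojK.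
by apply: (qmap_inj (q := c)); rewrite [LHS]pb_hcK vsprojK.
Qed.

Lemma pullback_comm (W D E : qspace) (b : qmor D W) (c : qmor E W) z :
  b (pb_legb b c z) = c (pb_legc b c z).
Proof. by rewrite [LHS]pb_hbK [RHS]pb_hcK. Qed.

(** Recognition of composites: the last two hypotheses make [apex u] a pullback of the inner legs.
    Surjectivity is only asked on the side of [p], since [lleg t] is injective and so [x] determines
    [y]. *)
Lemma span_comp_iso (U V W : qspace) (s : span U V) (t : span V W)
    (u : span U W) (p : qmor (apex u) (apex s)) (q : qmor (apex u) (apex t)) :
  (forall z, lleg s (p z) = lleg u z) -> (forall z, rleg t (q z) = rleg u z) ->
  (forall z, rleg s (p z) = lleg t (q z)) ->
  (forall x y, rleg s x = lleg t y -> exists z, p z = x) ->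
  span_iso (span_comp s t) u.
Proof.
move=> lE rE comm univ.
have le : (limg (qmap (pb_legb (rleg s) (lleg t))) <= limg (qmap p))%VS.
  apply/limg_leP => z; have [x <-] := univ _ _ (pullback_comm z).
  by exists x.
pose h : qmor (apex (span_comp s t)) (apex u) := qlift le.
have ph z : p (h z) = pb_legb (rleg s) (lleg t) z by apply: qliftK.
exists h; split; [apply: onto_bij; apply/ontoP|split] => z.
- have [w [wp _]] := pullbackP (comm z).
  by exists w; apply: (qmap_inj (q := p)); rewrite ph wp.
- by rewrite -lE ph /= comp_lfunE.
- rewrite -rE /= comp_lfunE; congr (rleg t _).
  by apply: (qmap_inj (q := lleg t)); rewrite -comm ph pullback_comm.
Qed.

(** If [y = rleg s x], the point of the pullback lying over [lleg s x] has first component [x] by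
    injectivity, and its second component is sent to [y]. *)
Lemma onto_lleg_comp (U V W : qspace) (s : span U V) (t : span V W) :
  onto (rleg s) -> onto (lleg (span_comp s t)) -> onto (lleg t).
Proof.
move=> /ontoP r_surj /ontoP l_surj; apply/ontoP => y.
have [x <-] := r_surj y; have [z] := l_surj (lleg s x).
rewrite [_ z]comp_lfunE => /qmap_inj <-.
by exists (pb_legc (rleg s) (lleg t) z); rewrite -pullback_comm.
Qed.

Lemma onto_rleg_comp (U V W : qspace) (s : span U V) (t : span V W) :
  onto (rleg (span_comp s t)) ->
  (limg (qmap (lleg t)) <= limg (qmap (rleg s)))%VS.
Proof.
move=> /ontoP r_surj; apply/limg_leP => x.
have [z] := r_surj (rleg t x); rewrite [_ z]comp_lfunE => /qmap_inj <-.
by exists (pb_legb (rleg s) (lleg t) z); rewrite pullback_comm.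
Qed.

Lemma Fmor_comp_iso (F : SpFunctor) (U V W : qspace)
    (s : span U V) (t : span V W) (u : span U W)
    (p : qmor (apex u) (apex s)) (q : qmor (apex u) (apex t)) :
  (forall z, lleg s (p z) = lleg u z) -> (forall z, rleg t (q z) = rleg u z) ->
  (forall z, rleg s (p z) = lleg t (q z)) ->
  (forall x y, rleg s x = lleg t y -> exists z, p z = x) ->
  forall x, Fmor F t (Fmor F s x) = Fmor F u x.
Proof.
by move=> lE rE comm univ x; rewrite -Fmor_comp; apply/Fmor_iso/(span_comp_iso lE).
Qed.

Definition span_l (V W : qspace) (f : qmor V W) : span W V := Span f (qmor_id V).
Definition span_r (V W : qspace) (f : qmor V W) : span V W := Span (qmor_id V) f.

(** * Primitive parts of a functor on spans *)

Section Primitive.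
Variable F : SpFunctor.

Definition primitive (V : qspace) (x : Fobj F V) : Prop :=
  forall (W : qspace) (s : span V W), ~~ onto (lleg s) -> Fmor F s x = 0.

Lemma primitive0 V : primitive (0 : Fobj F V).
Proof. by move=> W s _; rewrite linear0. Qed.

Lemma primitive_linear V (a : F2) (x y : Fobj F V) :
  primitive x -> primitive y -> primitive (a *: x + y).
Proof.
by move=> x_prim y_prim W s ls; rewrite lappP x_prim ?y_prim // scaler0 addr0.
Qed.

Definition prim (V : qspace) : submodule (Fobj F V) :=
  Submodule (@primitive0 V) (@primitive_linear V).

Lemma primitive_Fmor (V W : qspace) (s : span V W) (x : Fobj F V) :
  onto (rleg s) -> primitive x -> primitive (Fmor F s x).
Proof.
move=> rs x_prim X t lt; rewrite -Fmor_comp x_prim //.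
by apply: contra lt; apply: onto_lleg_comp.
Qed.

Definition idem (V : qspace) (U : {vspace V}) : span V V := Span (qincl U) (qincl U).

Lemma Fmor_idemr (V W : qspace) (s : span V W) (U : {vspace W}) (x : Fobj F V) :
  (limg (qmap (rleg s)) <= U)%VS -> Fmor F (idem U) (Fmor F s x) = Fmor F s x.
Proof.
rewrite -{1}[U]limg_qincl => rU.
apply: (@Fmor_comp_iso F _ _ _ s (idem U) s (qmor_id _) (qlift rU)) => [z|z|z|z y _].
- by rewrite /= id_lfunE.
- exact: qliftK.
- rewrite [LHS]/= id_lfunE; symmetry; exact: (qliftK rU).
- by exists z; rewrite /= id_lfunE.
Qed.

Lemma Fmor_ideml (V W : qspace) (s : span V W) (U : {vspace V}) (x : Fobj F V) :
  (limg (qmap (lleg s)) <= U)%VS -> Fmor F s (Fmor F (idem U) x) = Fmor F s x.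
Proof.
rewrite -{1}[U]limg_qincl => lU.
apply: (@Fmor_comp_iso F _ _ _ (idem U) s s (qlift lU) (qmor_id _)) => [z|z|z|y z e].
- exact: qliftK.
- by rewrite /= id_lfunE.
- by rewrite [RHS]/= id_lfunE; apply: qliftK.
- by exists z; apply: (qmap_inj (q := qincl U)); rewrite qliftK; exact: esym e.
Qed.

(** The pullback of the inclusions of two subspaces is their intersection. *)
Lemma Fmor_idemI (V : qspace) (U W : {vspace V}) (x : Fobj F V) :
  Fmor F (idem W) (Fmor F (idem U) x) = Fmor F (idem (U :&: W)%VS) x.
Proof.
have leU : (limg (qmap (qincl (U :&: W)%VS)) <= limg (qmap (qincl U)))%VS.
  by rewrite !limg_qincl capvSl.
have leW : (limg (qmap (qincl (U :&: W)%VS)) <= limg (qmap (qincl W)))%VS.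
  by rewrite !limg_qincl capvSr.
apply: (@Fmor_comp_iso F _ _ _ (idem U) (idem W) (idem (U :&: W)%VS)
  (qlift leU) (qlift leW)) => [z|z|z|y z e].
- exact: qliftK.
- exact: qliftK.
- by rewrite [LHS]qliftK [RHS]qliftK.
- have /memv_imgP[w _ wE] : qincl U y \in limg (qmap (qincl (U :&: W)%VS)).
    by rewrite limg_qincl memv_cap mem_qincl [qincl U y]e mem_qincl.
  by exists w; apply: (qmap_inj (q := qincl U)); rewrite qliftK -wE.
Qed.

Lemma Fmor_idemC (V : qspace) (U W : {vspace V}) (x : Fobj F V) :
  Fmor F (idem W) (Fmor F (idem U) x) = Fmor F (idem U) (Fmor F (idem W) x).
Proof. by rewrite !Fmor_idemI capvC. Qed.

(** Every span factors through [idem] of the image of its left leg, so the proper idempotents alone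
    detect primitivity. *)
Lemma primitiveP (V : qspace) (x : Fobj F V) :
  (forall U : {vspace V}, U != fullv -> Fmor F (idem U) x = 0) -> primitive x.
Proof.
move=> x0 W s ls.
by rewrite -(@Fmor_ideml _ _ s (limg (qmap (lleg s)))) // x0 ?linear0.
Qed.

Lemma primitive_idem (V : qspace) (x : Fobj F V) (U : {vspace V}) :
  primitive x -> U != fullv -> Fmor F (idem U) x = 0.
Proof. by move=> x_prim U_proper; apply: x_prim; rewrite /onto limg_qincl. Qed.

(** The product of the commuting projectors [1 - F (idem U)] for [U] in [s]. Over all proper
    subspaces it is the projector onto the primitive part. *)
Definition sieve (V : qspace) (s : seq {vspace V}) (x : Fobj F V) : Fobj F V :=
  foldr (fun U y => y - Fmor F (idem U) y) x s.

Lemma sieve_linear (V : qspace) (s : seq {vspace V}) a x y :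
  sieve s (a *: x + y) = a *: sieve s x + sieve s y.
Proof.
by elim: s => //= U s ->; rewrite lappP opprD addrACA -scalerBr.
Qed.

Lemma idem_sieve (V : qspace) (s : seq {vspace V}) U x :
  Fmor F (idem U) (sieve s x) = sieve s (Fmor F (idem U) x).
Proof. by elim: s => //= W s IH; rewrite linearB /= Fmor_idemC IH. Qed.

Lemma sieve_idem (V : qspace) (s : seq {vspace V}) U x :
  U \in s -> sieve s (Fmor F (idem U) x) = 0.
Proof.
elim: s => //= W s IH; rewrite in_cons => /predU1P[->|/IH->].
  by rewrite -idem_sieve Fmor_idemI capvv subrr.
by rewrite linear0 subr0.
Qed.

(** Each factor [1 - F (idem U)] becomes invisible after [h]. *)
Lemma sieve_absorb (V : qspace) (A : lmodType F2) (h : linmap (Fobj F V) A)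
    (s : seq {vspace V}) x :
  (forall U, U \in s -> forall y, h (Fmor F (idem U) y) = 0) ->
  h (sieve s x) = h x.
Proof.
elim: s => //= U s IH hs; rewrite linearB /= hs ?mem_head // subr0 IH // => W Ws.
by apply: hs; rewrite in_cons Ws orbT.
Qed.

Definition proper_subspaces (V : qspace) : seq {vspace V} :=
  [seq U <- projT1 (boolp.cid (vspace_enum V)) | U != fullv].

Lemma mem_proper_subspaces (V : qspace) (U : {vspace V}) :
  (U \in proper_subspaces V) = (U != fullv).
Proof.
rewrite mem_filter; case: boolp.cid => s [_ s_all] /=.
by rewrite s_all andbT.
Qed.

Lemma sieve_primitive (V : qspace) (x : Fobj F V) :
  primitive (sieve (proper_subspaces V) x).
Proof.
by apply: primitiveP => U Uf; rewrite idem_sieve sieve_idem ?mem_proper_subspaces.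
Qed.

Definition pproj (V : qspace) : linmap (Fobj F V) (sm_elt (prim V)).
Proof.
refine (@LinMap (Fobj F V) (sm_elt (prim V)) 
  (fun x => @SmElt _ (prim V) _ (sieve_primitive x)) _).
by move=> a x y; apply: sm_val_inj; apply: sieve_linear.
Defined.

Lemma pproj_id (V : qspace) (x : Fobj F V) :
  (forall U : {vspace V}, U != fullv -> Fmor F (idem U) x = 0) ->
  pproj V x = x :> Fobj F V.
Proof.
move=> x0; rewrite /=.
(* Properness of the members is recorded in a form that survives induction on the list. *)
have : all (fun U => U != fullv) (proper_subspaces V).
  by apply/allP => U; rewrite mem_proper_subspaces.
elim: (proper_subspaces V) => //= U s IH /andP[Uf /IH->].
by rewrite x0 // subr0.
Qed.

Lemma pproj_primitive (V : qspace) (x : sm_elt (prim V)) : pproj V x = x.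
Proof.
apply: sm_val_inj; apply: pproj_id => U; apply: primitive_idem.
exact: (sm_valP x).
Qed.

(** The element [Fmor F s x] is fixed by [idem] of the image of the right leg, a proper subspace,
    and the sieve kills the range of that idempotent. *)
Lemma pproj_Fmor0 (V W : qspace) (s : span V W) x :
  ~~ onto (rleg s) -> pproj W (Fmor F s x) = 0.
Proof.
move=> rs; rewrite -(@Fmor_idemr _ _ s (limg (qmap (rleg s)))) //.
by apply: sm_val_inj; rewrite /= sieve_idem // mem_proper_subspaces.
Qed.

Definition prim_map (V W : qspace) (s : span V W) (rs : onto (rleg s)) :
  linmap (sm_elt (prim V)) (sm_elt (prim W)) :=
  sm_map (S := prim V) (T := prim W) (f := Fmor F s) (fun x => @primitive_Fmor V W s x rs).

(** The right-hand side is the projection of [Fmor F s] applied to the sieved [x], and the sieve is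
    absorbed by the projection on [W]. *)
Lemma pproj_Fmor (V W : qspace) (s : span V W) (ls : onto (lleg s))
    (rs : onto (rleg s)) x :
  pproj W (Fmor F s x) = prim_map rs (pproj V x).
Proof.
rewrite -[RHS]pproj_primitive /=.
have /= <- // := @sieve_absorb V _ (linmap_comp (pproj W) (Fmor F s))
  (proper_subspaces V) x.
move=> U; rewrite mem_proper_subspaces => U_proper y.
(* Were the right leg of the composite onto, the image of [lleg s], which is all of [V], would lie
   in [U]. *)
rewrite -[LHS]/(pproj W (Fmor F s (Fmor F (idem U) y))) -Fmor_comp pproj_Fmor0 //; apply: contra U_proper => /onto_rleg_comp.
by rewrite (eqP ls) limg_qincl => /= fU; rewrite eqEsubv subvf.
Qed.

Definition prim_act (V : qspace) (g : 'Hom(V, V)) (Hg : isometry g) :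
  linmap (sm_elt (prim V)) (sm_elt (prim V)) :=
  prim_map (s := span_r (isometry_qmor Hg)) (isometry_onto Hg).

Lemma prim_act_id (V : qspace) (H : isometry (\1%VF : 'Hom(V, V))) x :
  prim_act H x = x.
Proof.
apply: sm_val_inj; rewrite /= -[RHS]Fmor_id.
congr (Fmor F _ _); congr Span; exact: qmor_ext.
Qed.

Lemma prim_act_comp (V : qspace) (g h : 'Hom(V, V)) (Hg : isometry g)
    (Hh : isometry h) (Hgh : isometry (g \o h)%VF) x :
  prim_act Hgh x = prim_act Hg (prim_act Hh x).
Proof.
apply: sm_val_inj; rewrite /=; symmetry.
apply: (@Fmor_comp_iso F _ _ _ (span_r (isometry_qmor Hh)) (span_r (isometry_qmor Hg))
  (span_r (isometry_qmor Hgh)) (qmor_id V) (isometry_qmor Hh)) => [z|z|z|z y _] /=.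
- by rewrite !id_lfunE.
- by rewrite comp_lfunE.
- by rewrite !id_lfunE.
- by exists z; rewrite id_lfunE.
Qed.

Definition prim_omod (V : qspace) : OMod V :=
  OModule (@prim_act_id V) (@prim_act_comp V).

Lemma Fmor_span_lr (V W : qspace) (f : qmor V W) x :
  Fmor F (span_r f) (Fmor F (span_l f) x) = Fmor F (Span f f) x.
Proof.
apply: (@Fmor_comp_iso F _ _ _ (span_l f) (span_r f) (Span f f) (qmor_id V)
  (qmor_id V)) => [z|z|z|z y _] /=; rewrite ?id_lfunE //.
by exists z; rewrite id_lfunE.
Qed.

Lemma Fmor_span_ll (U V W : qspace) (f : qmor V W) (g : qmor U V) x :
  Fmor F (span_l g) (Fmor F (span_l f) x) = Fmor F (span_l (qmor_comp f g)) x.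
Proof.
apply: (@Fmor_comp_iso F _ _ _ (span_l f) (span_l g) (span_l (qmor_comp f g)) g
  (qmor_id U)) => [z|z|z|y z] /=; rewrite ?comp_lfunE ?id_lfunE // => e.
by exists z; rewrite -e.
Qed.

Lemma Fmor_onto (V W : qspace) (f : qmor V W) x :
  onto f -> Fmor F (Span f f) x = x.
Proof.
move=> f_onto; rewrite -[RHS]Fmor_id; apply: Fmor_iso; exists f.
by split; [apply: onto_bij | split=> z; rewrite /= id_lfunE].
Qed.

(* Induction on [dim V]: the hypothesis restricts to proper subspaces, so all
   [F (idem U)] kill [x], and [x] equals its own primitive part. *)
Lemma pproj_separate (Q : qspace -> Prop) :
  (forall V : qspace, exists W (f : qmor W V), Q W /\ onto f) ->
  forall (V : qspace) (x : Fobj F V),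
    (forall W (f : qmor W V), Q W -> pproj W (Fmor F (span_l f) x) = 0) -> x = 0.
Proof.
move=> Qrep V; have [n] := ubnP (\dim (@fullv _ V)).
elim: n V => // n IH V ltVn x x0.
have xU (U : {vspace V}) : U != fullv -> Fmor F (idem U) x = 0.
  move=> U_proper; rewrite -Fmor_span_lr (IH (qsub U) _ (Fmor F (span_l (qincl U)) x)).
  - exact: linear0.
  - exact: leq_trans (dim_qsub_lt U_proper) _.
  - by move=> W f QW; rewrite Fmor_span_ll x0.
have [W [f [QW f_onto]]] := Qrep V.
have fx0 : Fmor F (span_l f) x = 0.
  (* Pulling back along the isometry [f] commutes with the projection, and [x] is its own projection
     by [xU]. *)
  have := pproj_Fmor (s := span_l f) f_onto (onto_id W) x.
  rewrite x0 // => /(congr1 (@sm_val _ _)).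
  by rewrite -[RHS]/(Fmor F (span_l f) (pproj V x)) pproj_id // => <-.
by rewrite -(Fmor_onto x f_onto) -Fmor_span_lr fx0 linear0.
Qed.
End Primitive.

(** * The functor induced from a family of modules *)

Section Induced.
Variables (J : Type) (R : J -> qspace) (N : forall j, OMod (R j)).

Definition ind_idx (V : qspace) := {j : J & qmor (R j) V}.
Definition ind_at (V : qspace) (j : J) (f : qmor (R j) V) : ind_idx V :=
  existT (fun j => qmor (R j) V) j f.
Definition ind_prod (V : qspace) : lmodType F2 :=
  dprod (fun t : ind_idx V => omod (N (projT1 t))).

Definition coherent (V : qspace) (m : ind_prod V) : Prop :=
  forall j (f : qmor (R j) V) g (Hg : isometry g),
    oact (N j) Hg (m (ind_at (qmor_comp f (isometry_qmor Hg)))) = m (ind_at f).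

Lemma coherent0 V : coherent (0 : ind_prod V).
Proof. by move=> j f g Hg; apply: linear0. Qed.

Lemma coherent_linear V (a : F2) (x y : ind_prod V) :
  coherent x -> coherent y -> coherent (a *: x + y).
Proof. by move=> xc yc j f g Hg; rewrite [LHS]lappP xc yc. Qed.

Definition ind (V : qspace) : submodule (ind_prod V) :=
  Submodule (@coherent0 V) (@coherent_linear V).

Lemma coherentE (V : qspace) (m : sm_elt (ind V)) j (f f' : qmor (R j) V)
    g (Hg : isometry g) :
  (forall x, f' x = f (g x)) ->
  oact (N j) Hg (sm_val m (ind_at f')) = sm_val m (ind_at f).
Proof.
move=> f'E; have -> : f' = qmor_comp f (isometry_qmor Hg).
  by apply: qmor_ext => x; rewrite /= comp_lfunE f'E.
exact: (sm_valP m).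
Qed.

(** The match on [idP] hands the first branch the proof of inclusion from which [qlift] builds the
    factorization of [f] through the right leg. *)
Definition ind_fun (V W : qspace) (s : span V W) (m : ind_prod V) : ind_prod W :=
  fun t => let: existT j f := t in
    match @idP (limg (qmap f) <= limg (qmap (rleg s)))%VS with
    | ReflectT H => m (ind_at (qmor_comp (lleg s) (qlift H)))
    | ReflectF _ => 0
    end.
Arguments ind_fun : simpl never.

(** Any factorization [f'] computes the value, because injectivity of [rleg s] makes it unique. *)
Lemma ind_fun_in (V W : qspace) (s : span V W) m j (f : qmor (R j) W)
    (f' : qmor (R j) (apex s)) :
  (forall x, rleg s (f' x) = f x) ->
  ind_fun s m (ind_at f) = m (ind_at (qmor_comp (lleg s) f')).
Proof.
move=> f'E; rewrite /ind_fun /=; case: {-}_ / idP => [H|[]]; last first.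
  by apply/limg_leP => x; exists (f' x).
congr (m (ind_at (qmor_comp _ _))); apply: qmor_ext => x.
by apply: (qmap_inj (q := rleg s)); rewrite qliftK f'E.
Qed.

Lemma ind_fun_out (V W : qspace) (s : span V W) m j (f : qmor (R j) W) :
  ~~ (limg (qmap f) <= limg (qmap (rleg s)))%VS -> ind_fun s m (ind_at f) = 0.
Proof. by move=> /negP nfs; rewrite /ind_fun /=; case: {-}_ / idP => // /nfs. Qed.

Lemma ind_fun_linear (V W : qspace) (s : span V W) (a : F2) x y :
  ind_fun s (a *: x + y) = a *: ind_fun s x + ind_fun s y.
Proof.
apply: functional_extensionality_dep => -[j f].
have [fs|fs] := boolP (limg (qmap f) <= limg (qmap (rleg s)))%VS.
  have e := qliftK fs; rewrite -[existT _ _ _]/(ind_at f) (ind_fun_in _ e).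
  by rewrite -[LHS]/(a *: x _ + y _) -!(ind_fun_in _ e).
rewrite -[existT _ _ _]/(ind_at f) ind_fun_out //.
by rewrite -[RHS]/(a *: ind_fun s x _ + ind_fun s y _) !ind_fun_out // scaler0 addr0.
Qed.

Lemma ind_fun_coherent (V W : qspace) (s : span V W) m :
  ind V m -> ind W (ind_fun s m).
Proof.
move=> mc j f g Hg.
have fgE x : qmor_comp f (isometry_qmor Hg) x = f (g x) by rewrite /= comp_lfunE.
have [fs|fs] := boolP (limg (qmap f) <= limg (qmap (rleg s)))%VS.
  rewrite (ind_fun_in _ (qliftK fs)).
  rewrite (@ind_fun_in _ _ _ _ _ _ (qmor_comp (qlift fs) (isometry_qmor Hg))).
    apply: (coherentE (@SmElt _ (ind V) m mc)) => x.
    by rewrite /= !comp_lfunE.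
  by move=> x; rewrite fgE [X in rleg s X]comp_lfunE qliftK.
(* As [g] is bijective, [f] and [f \o g] have the same image, so neither factors through
   [rleg s]. *)
rewrite !ind_fun_out ?linear0 //; apply: contra fs => /limg_leP fs.
apply/limg_leP => x; have [h _ gh] := Hg.1.
by have [y] := fs (h x); rewrite fgE gh => ->; exists y.
Qed.

Definition ind_mor (V W : qspace) (s : span V W) :
  linmap (sm_elt (ind V)) (sm_elt (ind W)) :=
  sm_map (S := ind V) (T := ind W) (f := LinMap (ind_fun_linear s))
    (@ind_fun_coherent V W s).

Lemma ind_ext (V : qspace) (m m' : sm_elt (ind V)) :
  (forall j (f : qmor (R j) V), sm_val m (ind_at f) = sm_val m' (ind_at f)) ->
  m = m'.
Proof.
move=> mm'; apply: sm_val_inj; apply: functional_extensionality_dep => -[j f].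
exact: mm'.
Qed.

Lemma ind_mor_iso (V W : qspace) (s t : span V W) :
  span_iso s t -> forall x, ind_mor s x = ind_mor t x.
Proof.
move=> [h [h_bij [lh rh]]] m; apply: ind_ext => j f /=.
have [fs|fs] := boolP (limg (qmap f) <= limg (qmap (rleg s)))%VS.
  rewrite (ind_fun_in _ (qliftK fs)) (@ind_fun_in _ _ _ _ _ _ (qmor_comp h (qlift fs))).
    congr (sm_val m (ind_at _)); apply: qmor_ext => x.
    by rewrite /= !comp_lfunE lh.
  by move=> x; rewrite [X in rleg t X]comp_lfunE rh qliftK.
rewrite !ind_fun_out //; apply: contra fs => /limg_leP ft; apply/limg_leP => x.
have [y ->] := ft x; have [h' _ hh'] := h_bij.
by exists (h' y); rewrite -rh hh'.
Qed.

Lemma ind_mor_id (V : qspace) x : ind_mor (span_id V) x = x.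
Proof.
apply: ind_ext => j f /=; rewrite (@ind_fun_in _ _ (span_id V) _ _ _ f).
  congr (sm_val x (ind_at _)); apply: qmor_ext => y.
  by rewrite /= comp_lfunE id_lfunE.
by move=> y; rewrite /= id_lfunE.
Qed.

(** By the pullback property, [f] factors through the composite exactly when it is [rleg t \o f']
    and [lleg t \o f'] in turn factors through [rleg s]; the three cases below follow these two
    conditions. *)
Lemma ind_mor_comp (U V W : qspace) (s : span U V) (t : span V W) x :
  ind_mor (span_comp s t) x = ind_mor t (ind_mor s x).
Proof.
apply: ind_ext => j f /=.
pose p := pb_legb (rleg s) (lleg t); pose q := pb_legc (rleg s) (lleg t).
have [ft|ft] := boolP (limg (qmap f) <= limg (qmap (rleg t)))%VS; last first.
  rewrite !ind_fun_out //; apply: contra ft => /limg_leP fst; apply/limg_leP => y.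
  by have [z ->] := fst y; exists (q z); rewrite /= comp_lfunE.
rewrite [RHS](ind_fun_in _ (qliftK ft)); set f' := qlift ft.
have f'E y : rleg t (f' y) = f y by apply: qliftK.
set f1 := qmor_comp _ _; have f1E y : f1 y = lleg t (f' y) by rewrite /= comp_lfunE.
have [fs|fs] := boolP (limg (qmap f1) <= limg (qmap (rleg s)))%VS.
  rewrite (ind_fun_in _ (qliftK fs)); set f'' := qlift fs.
  have f''E y : rleg s (f'' y) = f1 y by apply: qliftK.
  (* The compatible pair [f''], [f'] lands in the pullback; lifting [f''] through [p] gives the
     factorization of [f]. *)
  have fp : (limg (qmap f'') <= limg (qmap p))%VS.
    apply/limg_leP => y; have /pullbackP[z [<- _]] : rleg s (f'' y) = lleg t (f' y).
      by rewrite f''E f1E.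
    by exists z.
  have pE y : p (qlift fp y) = f'' y by apply: qliftK.
  rewrite (@ind_fun_in _ _ (span_comp s t) _ _ _ (qlift fp)) => [|y].
    congr (sm_val x (ind_at _)); apply: qmor_ext => y.
    rewrite [RHS]comp_lfunE [LHS]comp_lfunE -pE; exact: comp_lfunE.
  rewrite [LHS]comp_lfunE -f'E; congr (rleg t _).
  by apply: (qmap_inj (q := lleg t)); rewrite -pullback_comm -f1E -f''E -pE.
rewrite !ind_fun_out //; apply: contra fs => /limg_leP fst; apply/limg_leP => y.
have [z] := fst y; rewrite -f'E [in RHS]comp_lfunE => /qmap_inj f'y.
by exists (p z); rewrite f1E f'y pullback_comm.
Qed.

Definition ind_functor : SpFunctor := SpFun ind_mor_iso ind_mor_id ind_mor_comp.

End Induced.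

Arguments ind_fun : simpl never.

Section InducedNat.
Variables (J : Type) (R : J -> qspace).

Definition ind_map_fun (M N : forall j, OMod (R j)) (h : forall j, OHom (M j) (N j))
    (V : qspace) : linmap (ind_prod M V) (ind_prod N V).
Proof.
refine (@LinMap (ind_prod M V) (ind_prod N V) (fun m t => h (projT1 t) (m t)) _).
by move=> a x y; apply: functional_extensionality_dep => t; apply: lappP.
Defined.

Lemma ind_map_coherent (M N : forall j, OMod (R j)) (h : forall j, OHom (M j) (N j))
    (V : qspace) m : ind M V m -> ind N V (ind_map_fun h V m).
Proof. by move=> mc j f g Hg; rewrite /= -ohomP mc. Qed.

Definition ind_map (M N : forall j, OMod (R j)) (h : forall j, OHom (M j) (N j)) :
  NatTrans (ind_functor M) (ind_functor N).
Proof.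
refine (@NatT (ind_functor M) (ind_functor N) (fun V => sm_map (S := ind M V)
  (T := ind N V) (f := ind_map_fun h V) (@ind_map_coherent M N h V)) _).
move=> V W s m; apply: ind_ext => j f /=.
have [fs|fs] := boolP (limg (qmap f) <= limg (qmap (rleg s)))%VS.
  by rewrite !(ind_fun_in _ (qliftK fs)).
by rewrite !ind_fun_out ?linear0.
Defined.
End InducedNat.

(** * Unit and counit *)

(** By naturality [d] commutes with each idempotent, hence with the sieve. *)
Lemma pproj_ntc (F G : SpFunctor) (d : NatTrans F G) (V : qspace) (x : Fobj F V) :
  sm_val (pproj G V (d V x)) = d V (sm_val (pproj F V x)).
Proof.
by rewrite /=; elim: (proper_subspaces V) => //= U s ->; rewrite -ntcP linearB.
Qed.

Lemma primitive_ntc (F G : SpFunctor) (d : NatTrans F G) (V : qspace) (x : Fobj F V) :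
  prim F V x -> prim G V (d V x).
Proof. by move=> x_prim W s ls; rewrite -ntcP x_prim ?linear0. Qed.

Definition prim_ntc (F G : SpFunctor) (d : NatTrans F G) (V : qspace) :
  OHom (prim_omod F V) (prim_omod G V).
Proof.
refine (@OHomB V (prim_omod F V) (prim_omod G V)
  (sm_map (S := prim F V) (T := prim G V) (@primitive_ntc F G d V)) _).
by move=> g Hg x; apply: sm_val_inj; apply: ntcP.
Defined.

Section Unit.
Variables (J : Type) (R : J -> qspace).
Hypothesis R_reps : isometry_class_reps R.

Let R_onto (V : qspace) : exists j (f : qmor (R j) V), onto f.
Proof. by have [j /isometric_qmor[f fo]] := R_reps.1 V; exists j, f. Qed.

Section Fixed.
Variable F : SpFunctor.
Local Notation N := (fun j => prim_omod F (R j)).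

(** The coordinate at [f] restricts [x] along [f] and keeps the primitive component. *)
Definition unit_fun (V : qspace) : linmap (Fobj F V) (ind_prod N V).
Proof.
refine (@LinMap (Fobj F V) (ind_prod N V)
  (fun x t => pproj F _ (Fmor F (span_l (projT2 t)) x)) _).
by move=> a x y; apply: functional_extensionality_dep => t; rewrite !lappP.
Defined.

Lemma unit_coherent (V : qspace) x : coherent (unit_fun V x).
Proof.
move=> j f g Hg; set G := isometry_qmor Hg.
have Go : onto G by apply: isometry_onto.
(* Lifting the identity through [G] produces its inverse as a [qmor]. *)
have le := limg_le_onto (qmor_id (R j)) Go.
have GV z : G (qlift le z) = z by rewrite qliftK /= id_lfunE.
rewrite -[LHS]/(prim_act F Hg (pproj F _ (Fmor F (span_l (qmor_comp f G)) x))).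
rewrite -pproj_Fmor ?onto_id //; congr (pproj F _ _).
apply: (@Fmor_comp_iso F _ _ _ (span_l (qmor_comp f G)) (span_r G) (span_l f)
  (qlift le) (qlift le)) => [z|z|z|z y _].
- by rewrite [LHS]comp_lfunE GV.
- by rewrite [LHS]GV /= id_lfunE.
- by [].
- by exists (G z); apply: (qmap_inj (q := G)); rewrite GV.
Qed.

Definition unit_comp (V : qspace) : linmap (Fobj F V) (sm_elt (ind N V)).
Proof.
refine (@LinMap (Fobj F V) (sm_elt (ind N V))
  (fun x => @SmElt _ (ind N V) _ (unit_coherent x)) _).
by move=> a x y; apply: sm_val_inj; apply: (lappP (unit_fun V)).
Defined.

Lemma unit_nat (V W : qspace) (s : span V W) x :
  unit_comp W (Fmor F s x) = Fmor (ind_functor N) s (unit_comp V x).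
Proof.
apply: ind_ext => j f.
rewrite -[LHS]/(pproj F _ (Fmor F (span_l f) (Fmor F s x))).
rewrite -[RHS]/(ind_fun s (unit_fun V x) (ind_at f)).
have [fs|fs] := boolP (limg (qmap f) <= limg (qmap (rleg s)))%VS.
  rewrite (ind_fun_in _ (qliftK fs)); congr (pproj F _ _) => /=.
  apply: (@Fmor_comp_iso F _ _ _ s (span_l f) (span_l (qmor_comp (lleg s) (qlift fs)))
    (qlift fs) (qmor_id _)) => [z|z|z|y z e].
  - by rewrite [RHS]comp_lfunE.
  - by rewrite /= !id_lfunE.
  - by rewrite [X in lleg _ X]id_lfunE; apply: qliftK.
  - by exists z; apply: (qmap_inj (q := rleg s)); rewrite qliftK e.
rewrite ind_fun_out // -Fmor_comp pproj_Fmor0 //.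
by apply: contra fs => /onto_rleg_comp.
Qed.

Definition unit_nt : NatTrans F (ind_functor N) :=
  @NatT F (ind_functor N) unit_comp unit_nat.

Lemma unit_inj (V : qspace) : injective (unit_nt V).
Proof.
move=> x y xy; apply/eqP; rewrite -subr_eq0; apply/eqP.
apply: (@pproj_separate F (fun W => exists j, W = R j)) => [W|W f [j Wj]].
  by have [j [f fo]] := R_onto W; exists (R j), f; split; first by exists j.
subst W; rewrite !linearB; apply/eqP; rewrite subr_eq0; apply/eqP.
exact: (congr1 (fun m : sm_elt (ind N V) => sm_val m (ind_at f)) xy).
Qed.

(** Orthogonality of the summands. If the images differ, one leg of the composite span is not onto:
    a right leg is killed by the projection, a left leg by primitivity of the value of [m]. If they
    agree, [f] and [f0] differ by an isometry and coherence of [m] applies. *)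
Lemma pproj_span_rl (V : qspace) (m : sm_elt (ind N V)) j (f : qmor (R j) V)
    j0 (f0 : qmor (R j0) V) :
  pproj F _ (Fmor F (span_l f0) (Fmor F (span_r f) (sm_val (sm_val m (ind_at f))))) =
  if limg (qmap f) == limg (qmap f0) then sm_val m (ind_at f0) else 0.
Proof.
case: eqP => [ff0|ff0]; last first.
  rewrite -Fmor_comp; set s := span_comp _ _.
  have [rs|rs] := boolP (onto (rleg s)); last exact: pproj_Fmor0.
  have [ls|ls] := boolP (onto (lleg s)); last first.
    have xprim : primitive (sm_val (sm_val m (ind_at f))).
      exact: (sm_valP (sm_val m (ind_at f))).
    by rewrite xprim // linear0.
  case: ff0; apply/eqP; rewrite eqEsubv (onto_rleg_comp rs) andbT.
  apply/limg_leP => x; have /ontoP/(_ x)[z] := ls.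
  rewrite [LHS]comp_lfunE [LHS]/= id_lfunE => <-.
  by exists (pb_legc (rleg (span_r f)) (lleg (span_l f0)) z); rewrite -pullback_comm.
have le : (limg (qmap f) <= limg (qmap f0))%VS by rewrite ff0.
have go : onto (qlift le).
  have /limg_leP le' : (limg (qmap f0) <= limg (qmap f))%VS by rewrite ff0.
  apply/ontoP => y; have [x fx] := le' y.
  by exists x; apply: (qmap_inj (q := f0)); rewrite qliftK.
(* The lift of [f] through [f0] is an isometry between two representatives, so their indices
   coincide. *)
have jj0 : j = j0 by apply: R_reps.2; apply: onto_isometric go.
subst j0; have Hg := onto_isometry go.
rewrite -(coherentE m (f := f0) (f' := f) Hg) => [|x]; last by rewrite qliftK.
rewrite -[RHS]pproj_primitive; congr (pproj F _ _).
apply: (@Fmor_comp_iso F _ _ _ (span_r f) (span_l f0) (span_r (isometry_qmor Hg))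
  (qmor_id _) (qlift le)) => [z|z|z|z y _].
- by rewrite /= !id_lfunE.
- by rewrite [LHS]/= id_lfunE.
- by rewrite [X in rleg _ X]id_lfunE; symmetry; apply: qliftK.
- by exists z; rewrite /= id_lfunE.
Qed.

(* The preimage of [m] is the sum over the subspaces [U] of [V] of the pushforward
   of [m f], where [f] is any embedding of a representative with image [U]. *)
Lemma unit_surj (V : qspace) (m : sm_elt (ind N V)) : exists x, unit_nt V x = m.
Proof.
have fU (U : {vspace V}) : exists t : ind_idx R V, limg (qmap (projT2 t)) = U.
  have [j [f fo]] := R_onto (qsub U); exists (ind_at (qmor_comp (qincl U) f)).
  by rewrite /= limg_comp (eqP fo) limg_qincl.
have [t tU] := choice fU; have [s [s_uniq s_all]] := vspace_enum V.
exists (\sum_(U <- s) Fmor F (span_r (projT2 (t U))) (sm_val (sm_val m (t U)))).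
apply: ind_ext => j f.
set x := \sum_(_ <- s) _.
rewrite -[LHS]/(pproj F _ (Fmor F (span_l f) x)) !linear_sum /=.
(* By orthogonality only the summand indexed by the image of [f] contributes; it occurs once because
   [s] has no repetition. *)
rewrite (bigD1_seq (limg (qmap f))) //= big1 => [|U Uf].
  move: (tU (limg (qmap f))); case: (t _) => j' f' /= f'f; rewrite addr0.
  by have := pproj_span_rl m f' f; rewrite f'f eqxx.
move: (tU U); case: (t U) => j' f' /= f'U.
by have := pproj_span_rl m f' f; rewrite f'U (negPf Uf).
Qed.
End Fixed.

Lemma unit_natural (F G : SpFunctor) (d : NatTrans F G) (V : qspace) x :
  unit_nt G V (d V x) = ind_map (fun j => prim_ntc d (R j)) V (unit_nt F V x).
Proof.
apply: ind_ext => j f; apply: sm_val_inj.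
rewrite -[LHS]/(sm_val (pproj G _ (Fmor G (span_l f) (d V x)))) -ntcP.
exact: pproj_ntc.
Qed.
End Unit.

(** * Invertibility of the action of isometries, and the counit *)

Lemma isometry_inv (V : qspace) (g : 'Hom(V, V)) : isometry g ->
  exists h : 'Hom(V, V), [/\ isometry h, (h \o g = \1)%VF & (g \o h = \1)%VF].
Proof.
move=> Hg; have le := limg_le_onto (qmor_id V) (isometry_onto Hg).
have gh x : g (qlift le x) = x.
  by rewrite -[LHS]/(isometry_qmor Hg _) qliftK /= id_lfunE.
have hg x : qlift le (g x) = x by apply: (bij_inj Hg.1); rewrite gh.
exists (qmap (qlift le)); split.
- by apply: onto_isometry; apply/ontoP => y; exists (g y).
- by apply/lfunP => x; rewrite comp_lfunE id_lfunE hg.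
- by apply/lfunP => x; rewrite comp_lfunE id_lfunE gh.
Qed.

Lemma oact_cancel (V : qspace) (M : OMod V) (g h : 'Hom(V, V)) (Hg : isometry g)
    (Hh : isometry h) : (h \o g = \1)%VF -> cancel (oact M Hg) (oact M Hh).
Proof.
move=> hg x; have Hhg : isometry (h \o g)%VF.
  by rewrite hg; apply: onto_isometry (onto_id V).
by rewrite -(oact_comp Hh Hg Hhg); move: Hhg; rewrite hg => H; apply: oact_id.
Qed.

Lemma oact_inj (V : qspace) (M : OMod V) (g : 'Hom(V, V)) (Hg : isometry g) :
  injective (oact M Hg).
Proof. by have [h [Hh hg _]] := isometry_inv Hg; apply/can_inj/(oact_cancel Hg Hh). Qed.

Lemma oact_surj (V : qspace) (M : OMod V) (g : 'Hom(V, V)) (Hg : isometry g) y :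
  exists x, oact M Hg x = y.
Proof.
have [h [Hh _ gh]] := isometry_inv Hg; exists (oact M Hh y).
exact: (oact_cancel Hh Hg).
Qed.

Section Counit.
Variables (J : Type) (R : J -> qspace) (N : forall j, OMod (R j)).
Hypothesis R_inj : forall i j, isometric (R i) (R j) -> i = j.

Definition counit_fun j : linmap (omod (prim_omod (ind_functor N) (R j))) (omod (N j)).
Proof.
refine (@LinMap (omod (prim_omod (ind_functor N) (R j))) (omod (N j))
  (fun m => sm_val (sm_val m) (ind_at (qmor_id (R j)))) _).
by move=> a x y.
Defined.

(** Pushing [m] along [g] and evaluating at the identity gives the value of [m] at the inverse of
    [g], which coherence turns into [g] acting on the value at the identity. *)
Definition counit j : OHom (prim_omod (ind_functor N) (R j)) (N j).
Proof.
refine (@OHomB _ (prim_omod (ind_functor N) (R j)) (N j) (counit_fun j) _).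
move=> g Hg m; set G := isometry_qmor Hg.
have le := limg_le_onto (qmor_id (R j)) (isometry_onto Hg : onto G).
have GV z : G (qlift le z) = z by rewrite qliftK /= id_lfunE.
rewrite -[LHS]/(ind_fun (span_r G) (sm_val (sm_val m)) (ind_at (qmor_id (R j)))).
rewrite (@ind_fun_in _ _ _ _ _ (span_r G) _ _ _ _ (qliftK le)).
symmetry; apply: coherentE => x.
rewrite /= id_lfunE; symmetry; rewrite comp_lfunE id_lfunE.
by apply: (qmap_inj (q := G)); apply: GV.
Defined.

(** The value of [m] at [f] is the value at the identity of the restriction of [m] along [f], and
    primitivity makes this restriction vanish. *)
Lemma prim_ind0 (V : qspace) (m : sm_elt (prim (ind_functor N) V)) j
    (f : qmor (R j) V) : ~~ onto f -> sm_val (sm_val m) (ind_at f) = 0.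
Proof.
move=> nf.
have /(congr1 (fun k : sm_elt (ind N (R j)) => sm_val k (ind_at (qmor_id (R j))))) :=
  sm_valP m _ (span_l f) nf.
rewrite [LHS](@ind_fun_in _ _ _ _ _ (span_l f) _ _ _ (qmor_id (R j))) => [|x].
  move=> e; rewrite -[RHS]e; congr (sm_val (sm_val m) (ind_at _)).
  by apply: qmor_ext => x; rewrite /= comp_lfunE id_lfunE.
by rewrite /= id_lfunE.
Qed.

(** A primitive family over [R j] is supported on the isometries of [R j], where coherence recovers
    it from its value at the identity. *)
Lemma counit_inj j : injective (counit j).
Proof.
move=> m m' mm'; apply: sm_val_inj; apply: ind_ext => i f.
have [fo|fo] := boolP (onto f); last by rewrite !prim_ind0.
have ij : i = j by apply: R_inj; apply: onto_isometric fo.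
subst i; have Hf := onto_isometry fo; apply: (@oact_inj _ _ _ Hf).
by rewrite !(@coherentE _ _ _ _ _ _ (qmor_id (R j)) f) // => x; rewrite /= id_lfunE.
Qed.

(** * The primitive family with a prescribed value at the identity *)

Section Delta.
Variables (j : J) (y : omod (N j)).

(** Coherence forces the value at an isometry [f] to be the element that [f] carries to [y]. *)
Definition delta_at (f : qmor (R j) (R j)) : omod (N j) :=
  if pselect (isometry (qmap f)) is left Hf
  then projT1 (boolp.cid (oact_surj Hf y)) else 0.

Definition delta : ind_prod N (R j) := fun t =>
  match pselect (j = projT1 t) with
  | left e => match e in _ = i return qmor (R i) (R j) -> omod (N i) with
              | erefl => delta_at
              end (projT2 t)
  | right _ => 0
  end.

Lemma delta_same f : delta (ind_at f) = delta_at f.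
Proof.
rewrite /delta /=; case: pselect => [e|[]//].
(* Any proof of [j = j] may be replaced by [erefl], which makes the transport in [delta] compute. *)
by rewrite (Prop_irrelevance e erefl).
Qed.

Lemma delta_isometry (f : qmor (R j) (R j)) (Hf : isometry (qmap f)) :
  oact (N j) Hf (delta (ind_at f)) = y.
Proof.
rewrite delta_same /delta_at; case: pselect => // Hf'.
by rewrite (Prop_irrelevance Hf Hf'); case: boolp.cid.
Qed.

Lemma delta_out i (f : qmor (R i) (R j)) : ~~ onto f -> delta (ind_at f) = 0.
Proof.
move=> nf; have [e|ne] := pselect (j = i).
  case: i / e f nf => f nf; rewrite delta_same /delta_at; case: pselect => // Hf.
  by case/negP: nf; apply: (isometry_onto Hf).
by rewrite /delta /=; case: pselect.
Qed.

Lemma delta_coherent : coherent delta.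
Proof.
move=> i f g Hg.
have [fo|fo] := boolP (onto f); last first.
  by rewrite !delta_out ?linear0 //; apply: contra fo; apply: onto_compl.
have ij : i = j by apply: R_inj; apply: onto_isometric fo.
subst i; have Hf := onto_isometry fo.
have Hfg : isometry (qmap (qmor_comp f (isometry_qmor Hg))).
  exact/onto_isometry/onto_comp/isometry_onto.
(* After acting by [f], both sides of the coherence equation become [y]. *)
apply: (@oact_inj _ _ _ Hf); rewrite -(oact_comp Hf Hg Hfg).
by rewrite delta_isometry; apply: (delta_isometry Hfg).
Qed.

(** If the left leg is not onto, no embedding factoring through it is onto, and [delta] vanishes on
    all of these. *)
Lemma delta_primitive :
  primitive (F := ind_functor N) (@SmElt _ (ind N (R j)) delta delta_coherent).
Proof.
move=> W s ls; apply: ind_ext => i f.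
rewrite -[LHS]/(ind_fun s delta (ind_at f)).
have [fs|fs] := boolP (limg (qmap f) <= limg (qmap (rleg s)))%VS.
  rewrite (ind_fun_in _ (qliftK fs)) delta_out //.
  by apply: contra ls; apply: onto_compl.
by rewrite ind_fun_out.
Qed.
End Delta.

Lemma counit_surj j y : exists m, counit j m = y.
Proof.
exists (@SmElt _ (prim (ind_functor N) (R j)) _ (delta_primitive y)).
have H := onto_isometry (onto_id (R j)).
by rewrite -[RHS](delta_isometry y H) oact_id.
Qed.
End Counit.

(** * The equivalence *)

Lemma natt_ext (F G : SpFunctor) (d e : NatTrans F G) :
  (forall V x, d V x = e V x) -> d = e.
Proof.
case: d e => d dP [e eP] /= de.
have {}de : d = e.
  by apply: functional_extensionality_dep => V; apply: linmap_ext; apply: de.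
by case: e / de eP => eP; congr NatT.
Qed.

Lemma ohom_ext (V : qspace) (M N : OMod V) (f g : OHom M N) : f =1 g -> f = g.
Proof.
case: f g => f fP [g gP] /= /linmap_ext fg.
by case: g / fg gP => gP; congr OHomB.
Qed.

Definition natt_inv (F G : SpFunctor) (d : NatTrans F G)
    (d_inj : forall V, injective (d V)) (d_surj : forall V y, exists x, d V x = y) :
  NatTrans G F.
Proof.
refine (@NatT G F (fun V => linv (d_inj V) (d_surj V)) _).
by move=> V W s x; apply: (d_inj W); rewrite ntcP !linvK.
Defined.

Definition ohom_inv (V : qspace) (M N : OMod V) (f : OHom M N)
    (f_inj : injective f) (f_surj : forall y, exists x, f x = y) : OHom N M.
Proof.
refine (@OHomB V N M (linv f_inj f_surj) _).
by move=> g Hg x; apply: (f_inj _ _); rewrite ohomP !linvK.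
Defined.

(* Indexing the products defining [ind_functor] by this type instead of [I] avoids
   bounding the universe of [I] by that of the modules. *)
Definition qcode := {n : nat & 'rV[F2]_n -> F2}.

Definition coded (V : qspace) (k : qcode) : Prop :=
  exists f : 'Hom('rV[F2]_(projT1 k), V),
    bijective f /\ forall x, qform V (f x) = projT2 k x.

Lemma linear_hom_ex (K : fieldType) (U V : vectType K) (f : U -> V) :
  linear f -> exists h : 'Hom(U, V), forall x, h x = f x.
Proof.
move=> f_lin; pose fL := GRing.isLinear.Build K U V *:%R f f_lin.
pose h : {linear U -> V} := HB.pack f fL.
by exists (linfun h) => x; rewrite lfunE.
Qed.

Lemma coordinates_ex (K : fieldType) (V : vectType K) :
  exists f : 'Hom('rV[K]_(\dim {:V}), V), bijective f.
Proof.
have basisV := vbasisP {:V}.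
have [f fE] := linear_hom_ex (passmx.vecof_linear (vbasis {:V})).
exists f; exists (passmx.rVof (vbasis {:V})) => x;
  by rewrite fE ?passmx.vecofK ?passmx.rVofK.
Qed.

Lemma coded_ex (V : qspace) : exists k, coded V k.
Proof.
have [f f_bij] := coordinates_ex V.
by exists (existT (fun n => 'rV[F2]_n -> F2) (\dim {:V}) (fun x => qform V (f x))), f.
Qed.

Lemma coded_isometric (V W : qspace) k : coded V k -> coded W k -> isometric V W.
Proof.
move=> [f [f_bij fq]] [g [g_bij gq]].
have f_ker : lker f == 0%VS by apply/lker0P/bij_inj.
have fK : cancel f^-1%VF f.
  by move=> y; have [h _ fh] := f_bij; rewrite -[y]fh lker0_lfunK.
have fVK : cancel f f^-1%VF by apply: lker0_lfunK.
exists (g \o f^-1)%VF; split=> [|x]; last by rewrite comp_lfunE gq -fq fK.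
apply: (eq_bij (bij_comp g_bij (Bijective fK fVK))) => x.
by rewrite comp_lfunE.
Qed.

(** Representatives sharing a code are isometric, hence equal as indices, so [I] is in bijection
    with the codes that occur; these form [J]. *)
Lemma small_reps (I : Type) (rep : I -> qspace) : isometry_class_reps rep ->
  exists (J : Type) (c : J -> I),
    (forall i, exists j, c j = i) /\ isometry_class_reps (fun j => rep (c j)).
Proof.
move=> [rep_ex rep_uniq]; have [code codeP] := choice (fun i => coded_ex (rep i)).
have [c cP] := choice (fun k : {k | exists i, code i = k} => svalP k).
have c_surj i : exists j, c j = i.
  pose k : {k | exists i, code i = k} := exist _ (code i) (ex_intro _ i erefl).
  exists k; apply: rep_uniq; apply: coded_isometric (codeP i).
  by have := codeP (c k); rewrite cP.
exists _, c; split=> //; split=> [V|j k /rep_uniq cjk].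
  by have [i Vi] := rep_ex V; have [j ji] := c_surj i; exists j; rewrite ji.
(* Each element of [J] is the code of its image under [c], so [c] is injective. *)
have /= := cP j; rewrite cjk cP => /esym.
by case: j k {cjk} => [j jP] [k kP] /= jk; apply: eq_exist.
Qed.

Section Equivalence.
Variables (I J : Type) (rep : I -> qspace) (c : J -> I).
Hypothesis c_surj : forall i, exists j, c j = i.
Hypothesis c_reps : isometry_class_reps (fun j => rep (c j)).

Definition prim_functor : Functor Fiso_cat (prod_OMod_cat rep).
Proof.
refine (@Fun Fiso_cat (prod_OMod_cat rep) (fun F i => prim_omod F (rep i))
  (fun F G d i => prim_ntc d (rep i)) _ _).
- by move=> F; apply: functional_extensionality_dep => i; apply: ohom_ext => x;
    apply: sm_val_inj.
- by move=> F G H d e; apply: functional_extensionality_dep => i; apply: ohom_ext => x;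
    apply: sm_val_inj.
Defined.

Definition induction_functor : Functor (prod_OMod_cat rep) Fiso_cat.
Proof.
refine (@Fun (prod_OMod_cat rep) Fiso_cat
  (fun M => ind_functor (fun j => M (c j)))
  (fun M N h => ind_map (fun j => h (c j))) _ _).
- by move=> M; apply: natt_ext => V x; apply: ind_ext.
- by move=> L M N g h; apply: natt_ext => V x; apply: ind_ext.
Defined.

(** The counit lives over [c j], the product over [i]. Keeping the equality [e] general lets each
    property of the transported map be reduced to [erefl]. *)
Definition counit_eq (M : forall i, OMod (rep i)) j i (e : c j = i) :
  OHom (prim_omod (ind_functor (fun j => M (c j))) (rep i)) (M i) :=
  match e with erefl => @counit J (fun j => rep (c j)) (fun j => M (c j)) j end.

Lemma counit_eq_inj M j i (e : c j = i) : injective (counit_eq M e).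
Proof. by case: i / e => /=; apply: (counit_inj c_reps.2). Qed.

Lemma counit_eq_surj M j i (e : c j = i) y : exists x, counit_eq M e x = y.
Proof. by case: i / e y => /= y; apply: (counit_surj c_reps.2 y). Qed.

Lemma counit_eq_natural (M N : forall i, OMod (rep i)) (h : forall i, OHom (M i) (N i))
    j i (e : c j = i) x :
  counit_eq N e (prim_ntc (ind_map (fun j => h (c j))) (rep i) x) =
  h i (counit_eq M e x).
Proof. by case: i / e x. Qed.

Lemma induction_prim_iso : nat_iso (functor_comp induction_functor prim_functor) (functor_id Fiso_cat).
Proof.
pose R := fun j => rep (c j).
(* The isomorphism runs towards the identity functor, so the inverse of the unit comes first; its
   naturality is checked on elements of the form [unit_nt R F V y]. *)
exists (fun F => natt_inv (unit_inj c_reps (F := F)) (unit_surj c_reps (F := F))).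
exists (fun F => unit_nt R F); split=> [F|]; [|split=> [F|F G d]];
  apply: natt_ext => V x.
- exact: linvKV.
- exact: linvK.
- have [y <-] := unit_surj c_reps (F := F) x.
  transitivity (d V y); first by congr (d V _); apply: linvKV.
  apply: (unit_inj c_reps (F := G)); rewrite unit_natural; symmetry; exact: linvK.
Qed.

Lemma prim_induction_iso :
  nat_iso (functor_comp prim_functor induction_functor) (functor_id (prod_OMod_cat rep)).
Proof.
(* A section of [c] chooses, for each [i], the index at which the counit is taken. *)
have [s sK] := choice c_surj.
exists (fun M i => counit_eq M (sK i)).
exists (fun M i => ohom_inv (counit_eq_inj (M := M) (e := sK i))
  (counit_eq_surj (M := M) (sK i))).
split=> [M|]; [|split=> [M|M N h]];
  apply: functional_extensionality_dep => i; apply: ohom_ext => x.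
- exact: linvK.
- exact: linvKV.
- symmetry; exact: counit_eq_natural.
Qed.
End Equivalence.

Theorem theorem4p2 (I : Type) (rep : I -> qspace) :
  isometry_class_reps rep ->
  cat_equivalent Fiso_cat (prod_OMod_cat rep).
Proof.
move=> /small_reps[J [c [c_surj c_reps]]].
exists (prim_functor rep), (induction_functor rep c).
by split; [apply: induction_prim_iso | apply: prim_induction_iso].
Qed.
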